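(* Consider the two-dimensional OFDM signal $\mathbf{X}=\mathbf{F}_N^H\mathbf{S}\in\mathbb{C}^{N\times M}$, where $L$ entries of $\mathbf{S}$ are deterministic unit-amplitude pilots and the other $MN-L$ entries are i.i.d. random data symbols, as set out in the context. Then for all $k\in\mathbb{Z}_N$ and $q\in\mathbb{Z}_M$, $$\mathbb{E}\left(|\mathcal{X}^{\mathrm{FST}}(k,q)|^2\right)=M^2N^2\delta_{k,0}\delta_{q,0}+(\kappa-1)(MN-L).$$
   Context: Let $j$ be the imaginary unit, $N,M\ge 1$, $0\le L\le MN$, $\mathbb{Z}_N=\{0,\dots,N-1\}$, $\mathbb{Z}_M=\{0,\dots,M-1\}$; indices start from $0$. $\mathbf{F}_N$ is the normalized DFT matrix with entries $(\mathbf{F}_N)_{m,n}=\frac{1}{\sqrt N}e^{-j2\pi mn/N}$. Signal model. $\mathbf{S}\in\mathbb{C}^{N\times M}$ has $L$ fixed positions carrying deterministic pilot symbols of modulus $1$; the remaining $MN-L$ entries are i.i.d. random data symbols, each distributed as a complex random variable $d$ with finite fourth moment and $$\mathbb{E}(d)=0,\quad \mathbb{E}(|d|^2)=1,\quad \mathbb{E}(d^2)=0,\quad \mathbb{E}(d|d|^2)=\mathbb{E}(d^*|d|^2)=0.$$ The kurtosis is $\kappa=\mathbb{E}(|d|^4)$. Ambiguity function. $\mathbf{R}_{N,k}$ is the $N\times N$ cyclic shift, $(\mathbf{R}_{N,k}\mathbf{v})_n=v_{(n-k)\bmod N}$, and $\mathbf{\Phi}_{M,q}=\mathrm{Diag}(1,e^{j2\pi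 q/M},\dots,e^{j2\pi q(M-1)/M})$. With $\mathbf{x}=\operatorname{vec}(\mathbf{X})$ (column stacking), the fast-slow-time ambiguity function (FST-AF) is $$\mathcal{X}^{\mathrm{FST}}(k,q)=\mathbf{x}^H\left(\mathbf{\Phi}_{M,q}^*\otimes\mathbf{R}_{N,k}^T\right)\mathbf{x},$$ which for $\mathbf{X}=\mathbf{F}_N^H\mathbf{S}$ is the $(k,q)$ entry of $\sqrt{MN}\,\mathbf{F}_N^H|\mathbf{S}|^2\mathbf{F}_M$, where $|\mathbf{S}|^2$ is the entrywise squared modulus. $\delta_{a,b}$ is the Kronecker delta. *)

(* Defs.v *)
From HB Require Import structures.
From mathcomp Require Import all_boot all_order all_algebra.
From mathcomp Require Import all_classical all_reals all_analysis.
From mathcomp Require Import complex mxtens.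

Set Implicit Arguments.
Unset Strict Implicit.
Unset Printing Implicit Defensive.
Import Order.TTheory GRing.Theory Num.Theory Num.Def.
Import numFieldNormedType.Exports.

Local Open Scope ring_scope.
Local Open Scope complex_scope.
Local Open Scope sesquilinear_scope.

Section Matrices.
Variable R : realType.

Definition expj (t : R) : R[i] := cos t +i* sin t.

Definition dft_mx (N : nat) : 'M[R[i]]_N :=
  \matrix_(m < N, n < N)
    (((Num.sqrt N%:R)^-1)%:C * expj (- (2 * pi * m%:R * n%:R / N%:R))).

(* (cyclic_shift N k *m v) n = v ((n - k) mod N); adding N - k instead of
   subtracting k keeps the index in nat *)
Definition cyclic_shift (N : nat) (k : 'I_N) : 'M[R[i]]_N :=
  \matrix_(n < N, m < N) ((m : nat) == ((n + (N - k)) %% N)%N)%:R.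

Definition doppler_mx (M : nat) (q : 'I_M) : 'M[R[i]]_M :=
  diag_mx (\row_(m < M) expj (2 * pi * q%:R * m%:R / M%:R)).

(* column stacking: entry m * N + n is X n m, the index convention under which
   the blocks of A *t B (A of size M, B of size N) are A m m' *: B *)
Definition vec_col (N M : nat) (X : 'M[R[i]]_(N, M)) : 'cV[R[i]]_(M * N) :=
  \col_(i < M * N) X (mxtens_unindex i).2 (mxtens_unindex i).1.

Definition fst_af (N M : nat) (X : 'M[R[i]]_(N, M)) (k : 'I_N) (q : 'I_M)
    : R[i] :=
  ((vec_col X)^t* *m
     (map_mx conjC (doppler_mx q) *t (cyclic_shift k)^T) *m
   vec_col X) ord0 ord0.

Definition ofdm (N M : nat) (S : 'M[R[i]]_(N, M)) : 'M[R[i]]_(N, M) :=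
  (dft_mx N)^t* *m S.

End Matrices.

Local Open Scope classical_set_scope.
Local Open Scope ereal_scope.

Section ComplexRandomVariables.
Context {dT : measure_display} {T : measurableType dT} {R : realType}.
Variable P : probability T R.

Definition complex_rv (Z : T -> R[i]) : Prop :=
  measurable_fun setT (fun w => complex.Re (Z w)) /\
  measurable_fun setT (fun w => complex.Im (Z w)).

Definition re_im (z : R[i]) : measurableTypeR R * measurableTypeR R :=
  (complex.Re z, complex.Im z).

(* only meaningful when Z is integrable, because of fine *)
Definition cexpectation (Z : T -> R[i]) : R[i] :=
  fine 'E_P[fun w => complex.Re (Z w)] +i* fine 'E_P[fun w => complex.Im (Z w)].

(* Mutual independence of the family (Z i), i in D; Borel sets of the complex
   plane are the preimages under re_im of measurable subsets of the product. *)
Definition mutually_independent (I : finType) (D : {set I})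
    (Z : I -> T -> R[i]) : Prop :=
  forall (J : {set I}) (B : I -> set (measurableTypeR R * measurableTypeR R)),
    J \subset D -> (forall i, measurable (B i)) ->
    P (\bigcap_(i in [set` J]) [set w | B i (re_im (Z i w))]) =
    \prod_(i in J) P [set w | B i (re_im (Z i w))].

Definition kurtosis (d : T -> R[i]) : R :=
  fine 'E_P[fun w => (Normc.normc (d w) ^+ 4)%R].

Record data_symbol (d : T -> R[i]) : Prop := DataSymbol {
  data_rv : complex_rv d;
  data_moment4 : 'E_P[fun w => (Normc.normc (d w) ^+ 4)%R] < +oo;
  data_mean : cexpectation d = 0%R;
  data_power : 'E_P[fun w => (Normc.normc (d w) ^+ 2)%R] = 1;
  data_pseudo : cexpectation (fun w => (d w ^+ 2)%R) = 0%R;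
  data_skew : cexpectation (fun w => (d w * `|d w| ^+ 2)%R) = 0%R;
  data_skewc : cexpectation (fun w => (conjC (d w) * `|d w| ^+ 2)%R) = 0%R
}.

End ComplexRandomVariables.

Definition same_law {dT dT' : measure_display} {T : measurableType dT}
    {T' : measurableType dT'} {R : realType} (P : probability T R)
    (P' : probability T' R) (Z : T -> R[i]) (Z' : T' -> R[i]) : Prop :=
  forall B : set (measurableTypeR R * measurableTypeR R), measurable B ->
    P [set w | B (re_im (Z w))] = P' [set w | B (re_im (Z' w))].

(* S has deterministic unit-modulus entries at the positions in pilots; its
   other entries are i.i.d. with the law of d, which may live on another
   probability space. *)
Record symbol_matrix {dT dT' : measure_display} {T : measurableType dT}
    {T' : measurableType dT'} {R : realType} (P : probability T R)
    (P' : probability T' R) (N M : nat) (pilots : {set 'I_N * 'I_M})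
    (d : T' -> R[i]) (S : T -> 'M[R[i]]_(N, M)) : Prop := SymbolMatrix {
  pilot_entry : forall i, i \in pilots ->
    exists2 s : R[i], `|s|%R = 1%R & forall w, S w i.1 i.2 = s;
  data_entry_rv : forall i, i \notin pilots ->
    complex_rv (fun w => S w i.1 i.2);
  data_entry_law : forall i, i \notin pilots ->
    same_law P P' (fun w => S w i.1 i.2) d;
  data_entry_indep : mutually_independent P (~: pilots)%SET
    (fun i w => S w i.1 i.2)
}.

(* Main.v *)
(** The columns of the DFT matrix diagonalize cyclic shifts, so the ambiguity
function collapses to a weighted sum of the symbol powers [y_i = |S_i|^2],
  [X(k, q) = \sum_i c_i y_i],
where [c_i] is a product of an [N]-th and an [M]-th root of unity.  Hence
[|X|^2] is the sum of the [Re (c_i c_j^* ) y_i y_j].  By independence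
[E (y_i y_j) = 1] unless [i = j] is a data position, where it is the kurtosis.
The constant part [1] contributes [|\sum_i c_i|^2 = (M N)^2 \delta_k \delta_q]
by orthogonality of characters, and each of the [M N - L] data positions adds
[|c_i|^2 (kurtosis - 1) = kurtosis - 1]. *)

Require Import Defs.
From HB Require Import structures.
From mathcomp Require Import all_boot all_order all_algebra.
From mathcomp Require Import all_classical all_reals all_analysis.
From mathcomp Require Import measurable_realfun complex mxtens.
From mathcomp Require Import ring lra.
Import Order.TTheory GRing.Theory Num.Theory.
Local Open Scope ring_scope.

(** * Roots of unity and the closed form of the ambiguity function *)

Section RootsOfUnity.
Context {R : realType}.
Implicit Types (s t : R) (N n : nat).

Lemma expjD s t : expj (s + t) = expj s * expj t.
Proof.
rewrite /expj cosD sinD; apply/eqP.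
by rewrite eq_complex /= [_ * sin t + _]addrC !eqxx.
Qed.

Lemma expj0 : expj (0 : R) = 1.
Proof. by rewrite /expj cos0 sin0. Qed.

Lemma expjN t : expj (- t) = Num.conj (expj t).
Proof. by rewrite /expj cosN sinN. Qed.

Lemma expjMn t n : expj (t * n%:R) = expj t ^+ n.
Proof.
elim: n => [|n IHn]; first by rewrite mulr0 expj0.
by rewrite -natr1 mulrDr mulr1 expjD IHn exprSr.
Qed.

Lemma expj_conj t : expj t * Num.conj (expj t) = 1.
Proof. by rewrite -expjN -expjD subrr expj0. Qed.

Lemma expj2pi : expj (2 * pi : R) = 1.
Proof. by rewrite mulr_natl /expj cos2pi sin2pi. Qed.

(** The real part already differs from 1: [cos t = 1 - 2 * sin (t / 2) ^+ 2], and the sine is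
    positive because [t / 2] lies strictly between [0] and [pi]. *)
Lemma expj_neq1 t : 0 < t < 2 * pi -> expj t != 1.
Proof.
move=> /andP[t0 t2]; apply/eqP => -[c1 _].
have s0 : 0 < sin (t / 2) by apply: sin_gt0_pi; apply/andP; split; lra.
have := cos_mulr2n (t / 2); rewrite -[_ *+ 2]mulr_natr divfK ?pnatr_eq0// c1.
have := cos2Dsin2 (t / 2).
have : 0 < sin (t / 2) ^+ 2 by rewrite exprn_gt0.
lra.
Qed.

Definition zeta N : R[i] := expj (2 * pi / N%:R).

Lemma zetaXn N : (0 < N)%N -> zeta N ^+ N = 1.
Proof. by move=> N0; rewrite -expjMn divfK ?expj2pi// pnatr_eq0 -lt0n. Qed.

Lemma zeta_conj N : zeta N * Num.conj (zeta N) = 1.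
Proof. exact: expj_conj. Qed.

Lemma expj_zeta N (a b : nat) :
  expj (2 * pi * a%:R * b%:R / N%:R) = zeta N ^+ (a * b).
Proof. by rewrite -expjMn natrM; congr expj; ring. Qed.

Lemma zeta_neq1 N a : (0 < a < N)%N -> zeta N ^+ a != 1.
Proof.
move=> /andP[a0 aN]; rewrite -expjMn; apply: expj_neq1.
have N0 : (0 : R) < N%:R by rewrite ltr0n (leq_trans _ aN).
have pi0 := @pi_gt0 R.
apply/andP; split; first by rewrite mulr_gt0 ?divr_gt0 ?mulr_gt0 // ltr0n.
by rewrite mulrAC ltr_pdivrMr// ltr_pM2l ?mulr_gt0// ltr_nat.
Qed.

(** Geometric sum: multiplied by [x - 1] it gives [x ^+ N - 1 = 0], so it vanishes as soon as
    [x != 1]. *)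
Lemma sum_expr_unity (x : R[i]) N : x ^+ N = 1 ->
  \sum_(i < N) x ^+ i = (x == 1)%:R * N%:R.
Proof.
move=> xN; case: eqVneq => [->|x1].
  by under eq_bigr do rewrite expr1n; rewrite sumr_const card_ord mul1r.
apply/eqP; have := subrX1 x N; rewrite xN subrr => /esym/eqP.
by rewrite mulf_eq0 subr_eq0 (negbTE x1) /= mul0r.
Qed.

Lemma zetaX_eq1 N (k : 'I_N) : (zeta N ^+ k == 1) = ((k : nat) == 0%N).
Proof.
case: (posnP k) => [->|k0]; first by rewrite expr0 eqxx.
by rewrite (negbTE (zeta_neq1 _ _ _)) ?k0 ?ltn_ord// gtn_eqF.
Qed.

Lemma sum_zeta N (k : 'I_N) :
  \sum_(a < N) zeta N ^+ (a * k) = ((k : nat) == 0%N)%:R * N%:R.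
Proof.
rewrite -zetaX_eq1 -sum_expr_unity; last first.
  by rewrite exprAC zetaXn ?expr1n//; case: k => k; case: N.
by apply: eq_bigr => a _; rewrite mulnC exprM.
Qed.

(** The summand is the [n]-th power of a fixed [N]-th root of unity, so the sum is geometric; that
    root is 1 exactly when [a = b]. *)
Lemma zeta_orth N (a b : 'I_N) :
  \sum_(n < N) Num.conj (zeta N ^+ (a * n)) * zeta N ^+ (b * n) =
  (a == b)%:R * N%:R.
Proof.
have N0 : (0 < N)%N by case: a => a; case: N {b}.
have X1 c : Num.conj (zeta N) ^+ c * zeta N ^+ c = 1.
  by rewrite -exprMn mulrC zeta_conj expr1n.
rewrite (eq_bigr (fun n : 'I_N =>
  (Num.conj (zeta N) ^+ a * zeta N ^+ b) ^+ n)); last first.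
  by move=> n _; rewrite !exprM exprMn !rmorphXn.
rewrite sum_expr_unity; last first.
  by rewrite exprMn !(exprAC _ _ N) -rmorphXn zetaXn// rmorph1 !expr1n mul1r.
congr (_%:R * _); congr nat_of_bool.
(* Conjugation exchanges [a] and [b]. Once [a <= b], the root equals [zeta N ^+ (b - a)] with a
   natural exponent below [N]. *)
wlog ab : a b / (a <= b)%N.
  move=> H; case: (leqP a b) => [|/ltnW ba]; first exact: H.
  rewrite [RHS]eq_sym -(H b a ba) -(inj_eq (inv_inj (@conjCK _))).
  by rewrite rmorph1 rmorphM !rmorphXn /= conjCK mulrC.
rewrite -(subnK ab) exprD mulrCA X1 mulr1.
have lt : (b - a < N)%N by exact: leq_ltn_trans (leq_subr _ _) (ltn_ord b).
rewrite (zetaX_eq1 N (Ordinal lt)) /= subn_eq0.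
by rewrite -val_eqE /= eqn_leq ab.
Qed.

Lemma zeta_modn N n : (0 < N)%N -> zeta N ^+ (n %% N) = zeta N ^+ n.
Proof.
by move=> N0; rewrite {2}(divn_eq n N) exprD mulnC exprM zetaXn// expr1n mul1r.
Qed.

Lemma sum_mxtens (V : nmodType) m n (F : 'I_(m * n) -> V) :
  \sum_i F i = \sum_i \sum_j F (mxtens_index (i, j)).
Proof.
rewrite (reindex (@mxtens_index m n)).
  by rewrite [RHS]pair_big; apply: eq_bigr => -[].
by exists (@mxtens_unindex m n) => ? _; rewrite ?mxtens_indexK ?mxtens_unindexK.
Qed.

(** The index [n - k] modulo [N]: the only column in which row [n] of [cyclic_shift k] is
    nonzero. *)
Definition shift_ord {N} (k n : 'I_N) : 'I_N :=
  Ordinal (ltn_pmod (n + (N - k)) (leq_ltn_trans (leq0n k) (ltn_ord k))).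

(** A cyclic shift only modulates a character: the shifted index plus [k] is congruent to [n] modulo
    [N], and conjugation inverts a root of unity. *)
Lemma zeta_shift N (a k n : 'I_N) :
  Num.conj (zeta N ^+ (a * ((n + (N - k)) %% N))) =
  zeta N ^+ (a * k) * Num.conj (zeta N ^+ (a * n)).
Proof.
have N0 : (0 < N)%N by exact: leq_ltn_trans (leq0n k) (ltn_ord k).
have shiftk : zeta N ^+ (a * ((n + (N - k)) %% N)) * zeta N ^+ (a * k) =
    zeta N ^+ (a * n).
  rewrite -exprD -mulnDr /= -zeta_modn// -modnMmr modnDml -addnA.
  rewrite subnK; last exact: ltnW.
  by rewrite modnDr modnMmr zeta_modn.
have u x : Num.conj (zeta N ^+ x) * zeta N ^+ x = 1.
  by rewrite rmorphXn -exprMn mulrC zeta_conj expr1n.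
by rewrite -shiftk rmorphM mulrCA [_ * Num.conj _]mulrC u mulr1.
Qed.

(** The Doppler factor is diagonal and the shift factor a permutation matrix, so each column of
    their tensor product has a single nonzero entry. *)
Lemma fst_afE N M (X : 'M[R[i]]_(N, M)) (k : 'I_N) (q : 'I_M) :
  fst_af X k q = \sum_(m < M) \sum_(n < N)
    Num.conj (zeta M ^+ (q * m)) * (Num.conj (X (shift_ord k n) m) * X n m).
Proof.
rewrite /fst_af mxE sum_mxtens; apply: eq_bigr => m _; apply: eq_bigr => n _.
rewrite mxE sum_mxtens (bigD1 m)//= [X in _ + X]big1 ?addr0; last first.
  move=> m' m'm; apply: big1 => n' _.
  by rewrite tensmxE !mxE (negbTE m'm) mulr0n rmorph0 mul0r mulr0.
rewrite (bigD1 (shift_ord k n))//= [X in _ + X]big1 ?addr0; last first.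
  move=> n' n'n; rewrite tensmxE !mxE.
  by move: n'n; rewrite -val_eqE /= => /negbTE ->; rewrite !mulr0.
rewrite tensmxE !mxE !mxtens_indexK /= !eqxx mulr1 mulr1n expj_zeta.
ring.
Qed.

Lemma conjC_complexr (x : R) : Num.conj (x%:C)%C = (x%:C)%C.
Proof. exact: conjc_real. Qed.

Lemma ofdmE N M (S : 'M[R[i]]_(N, M)) (n : 'I_N) (m : 'I_M) :
  ofdm S n m = ((Num.sqrt N%:R)^-1)%:C%C * \sum_(a < N) zeta N ^+ (a * n) * S a m.
Proof.
rewrite !mxE mulr_sumr; apply: eq_bigr => a _.
by rewrite !mxE expjN expj_zeta rmorphM /= conjCK conjC_complexr mulrA.
Qed.

Lemma sqr_dft_scale N : (0 < N)%N ->
  Num.conj ((Num.sqrt N%:R : R)^-1)%:C%C * ((Num.sqrt N%:R)^-1)%:C%C = N%:R^-1.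
Proof.
move=> N0; rewrite conjC_complexr -rmorphM -invfM -expr2 sqr_sqrtr ?ler0n//.
by rewrite fmorphV rmorph_nat.
Qed.

(** In each column [m], both factors are expanded over subcarriers [a] and [b]. The shift
    contributes only [zeta N ^+ (a * k)], and orthogonality over [n] leaves the terms [a = b]. *)
Lemma fst_af_ofdm N M (S : 'M[R[i]]_(N, M)) (k : 'I_N) (q : 'I_M) :
  fst_af (ofdm S) k q =
  \sum_(m < M) \sum_(a < N)
    Num.conj (zeta M ^+ (q * m)) * zeta N ^+ (a * k) * `|S a m| ^+ 2.
Proof.
have N0 : (0 < N)%N by exact: leq_ltn_trans (leq0n k) (ltn_ord k).
rewrite fst_afE; apply: eq_bigr => m _; rewrite -mulr_sumr.
under [RHS]eq_bigr do rewrite -mulrA; rewrite -mulr_sumr; congr (_ * _).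
(* The dependence on [n] is isolated in the last factor, ready for [zeta_orth]; [N%:R^-1] comes from
   the two DFT normalizations and cancels the [N] produced there. *)
transitivity (\sum_(n < N) \sum_(a < N) \sum_(b < N) N%:R^-1 *
  (zeta N ^+ (a * k) * (Num.conj (S a m) * S b m)) *
  (Num.conj (zeta N ^+ (a * n)) * zeta N ^+ (b * n))).
  apply: eq_bigr => n _; rewrite !ofdmE rmorphM mulrACA sqr_dft_scale// rmorph_sum.
  rewrite big_distrlr mulr_sumr; apply: eq_bigr => a _.
  rewrite mulr_sumr; apply: eq_bigr => b _.
  by rewrite /= rmorphM /= zeta_shift; ring.
rewrite exchange_big; apply: eq_bigr => a _; rewrite exchange_big /=.
under eq_bigr do rewrite -mulr_sumr zeta_orth.
rewrite (bigD1 a)//= big1 ?addr0 => [|b ba]; last first.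
  by rewrite eq_sym (negbTE ba) mul0r mulr0.
rewrite eqxx mul1r normCK mulrAC mulVf ?pnatr_eq0 -?lt0n// mul1r.
by rewrite [S a m * _]mulrC.
Qed.

End RootsOfUnity.

(** * Integrals of nonnegative functions under equal laws and under independence *)

Section Integration.
Local Open Scope classical_set_scope.
Local Open Scope ereal_scope.

(** By change of variables both sides are integrals of [f] against image measures on [E], and these
    agree on measurable sets. *)
Lemma ge0_integral_eq_law {d1 d2 d : measure_display} {T1 : measurableType d1}
    {T2 : measurableType d2} {E : measurableType d} {R : realType}
    (P1 : {measure set T1 -> \bar R}) (P2 : {measure set T2 -> \bar R})
    (X1 : T1 -> E) (X2 : T2 -> E) (f : E -> \bar R) :
  measurable_fun setT X1 -> measurable_fun setT X2 ->
  (forall B, measurable B -> P1 (X1 @^-1` B) = P2 (X2 @^-1` B)) ->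
  measurable_fun setT f -> (forall x, 0 <= f x) ->
  \int[P1]_w f (X1 w) = \int[P2]_w f (X2 w).
Proof.
move=> mX1 mX2 lawX mf f0.
rewrite -[LHS]/(\int[P1]_(x in X1 @^-1` setT) (f \o X1) x).
rewrite -[RHS]/(\int[P2]_(x in X2 @^-1` setT) (f \o X2) x).
rewrite -!ge0_integral_pushforward//.
by apply: eq_measure_integral => B mB _; exact: lawX.
Qed.

(* Independence says that the law of [(X1, X2)] is the product of the two laws,
   so Tonelli applies. *)
Lemma ge0_integralM_indep {d d1 d2 : measure_display} {T : measurableType d}
    {E1 : measurableType d1} {E2 : measurableType d2} {R : realType}
    (P : probability T R) (X1 : T -> E1) (X2 : T -> E2)
    (f : E1 -> \bar R) (g : E2 -> \bar R) :
  measurable_fun setT X1 -> measurable_fun setT X2 ->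
  (forall A B, measurable A -> measurable B ->
    P (X1 @^-1` A `&` X2 @^-1` B) = P (X1 @^-1` A) * P (X2 @^-1` B)) ->
  measurable_fun setT f -> measurable_fun setT g ->
  (forall x, 0 <= f x) -> (forall x, 0 <= g x) ->
  \int[P]_w (f (X1 w) * g (X2 w)) = (\int[P]_w f (X1 w)) * \int[P]_w g (X2 w).
Proof.
move=> mX1 mX2 indep mf mg f0 g0.
pose X1m : {mfun T >-> E1} := HB.pack X1 (isMeasurableFun.Build _ _ _ _ _ mX1).
pose X2m : {mfun T >-> E2} := HB.pack X2 (isMeasurableFun.Build _ _ _ _ _ mX2).
have mX12 : measurable_fun setT (fun w => (X1 w, X2 w)).
  exact: measurable_fun_pair.
pose X12m : {mfun T >-> (E1 * E2)%type} :=
  HB.pack (fun w => (X1 w, X2 w)) (isMeasurableFun.Build _ _ _ _ _ mX12).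
pose mu1 : probability E1 R := distribution P X1m.
pose mu2 : probability E2 R := distribution P X2m.
pose h (z : E1 * E2) := f z.1 * g z.2.
have mh : measurable_fun setT h.
  by apply: emeasurable_funM;
    [exact: (measurableT_comp mf)|exact: (measurableT_comp mg)].
have h0 z : 0 <= h z by exact: mule_ge0.
transitivity (\int[pushforward P (fun w => (X1 w, X2 w))]_z h z).
  by rewrite ge0_integral_pushforward.
transitivity (\int[mu1 \x mu2]_z h z).
  apply: eq_measure_integral => A mA _; apply/esym.
  (* A measure that factors on measurable rectangles is the product measure; [indep] is this
     factorization for the joint law. *)
  exact: (@product_measure_unique _ _ _ _ _ mu1 mu2 (distribution P X12m)).
rewrite (fubini_tonelli1 h)//= /fubini_F/h/=.
under eq_integral do rewrite ge0_integralZl//.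
rewrite ge0_integralZr//; last exact: integral_ge0.
by rewrite !ge0_integral_pushforward.
Qed.

End Integration.

(** * Squared moduli as measurable functions of real and imaginary parts *)

Section ComplexModulus.
Local Open Scope classical_set_scope.
Context {R : realType}.
Local Notation RxR := (measurableTypeR R * measurableTypeR R)%type.

(** Defined on pairs of reals because laws and independence are stated through [re_im] on the
    product space. *)
Definition sqr_norm (p : RxR) : R := p.1 ^+ 2 + p.2 ^+ 2.

Lemma sqr_norm_ge0 p : 0 <= sqr_norm p.
Proof. by rewrite addr_ge0 ?sqr_ge0. Qed.

Lemma sqr_normc (z : R[i]) : Normc.normc z ^+ 2 = sqr_norm (re_im z).
Proof. by case: z => a b; rewrite /= sqr_sqrtr// addr_ge0 ?sqr_ge0. Qed.

Lemma normc4E (z : R[i]) : Normc.normc z ^+ 4 = sqr_norm (re_im z) ^+ 2.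
Proof. by rewrite -sqr_normc -exprM. Qed.

Lemma measurable_sqr_norm : measurable_fun setT sqr_norm.
Proof.
by apply: measurable_funD; apply: measurable_funX;
  [exact: measurable_fst|exact: measurable_snd].
Qed.

Lemma complex_rv_re_im d (T : measurableType d) (Z : T -> R[i]) :
  complex_rv Z -> measurable_fun setT (fun w => re_im (Z w) : RxR).
Proof. by case=> mRe mIm; exact: measurable_fun_pair. Qed.

End ComplexModulus.

(** * Squared modulus of a combination of reals with complex coefficients *)

Section SecondMoment.
Context {R : realType}.

Lemma sqr_normC (z : R[i]) : `|z| ^+ 2 = (sqr_norm (re_im z))%:C%C.
Proof. by rewrite -add_Re2_Im2. Qed.

Lemma sqr_normcE (z : R[i]) : Normc.normc z ^+ 2 = complex.Re (z * Num.conj z).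
Proof. by rewrite -normCK sqr_normC sqr_normc. Qed.

Lemma sqr_normc_nat n : Normc.normc (n%:R : R[i]) ^+ 2 = n%:R ^+ 2.
Proof.
apply: (@complexI R).
by rewrite sqr_normc -sqr_normC normr_nat rmorphXn rmorph_nat.
Qed.

(** Expansion of [z * Num.conj z]. Since this number is real, real parts may be taken term by term,
    which leaves only real functions to integrate. *)
Lemma sqr_normc_sum (I : finType) (c : I -> R[i]) (y : I -> R) :
  Normc.normc (\sum_i c i * (y i)%:C%C) ^+ 2 =
  \sum_i \sum_j complex.Re (c i * Num.conj (c j)) * (y i * y j).
Proof.
rewrite sqr_normcE rmorph_sum big_distrlr /= raddf_sum; apply: eq_bigr => i _.
rewrite raddf_sum; apply: eq_bigr => j _ /=.
rewrite rmorphM /= conjC_complexr mulrACA -rmorphM /=.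
by case: (c i * _) => u v /=; rewrite mulr0 subr0.
Qed.

End SecondMoment.

(** * First and second moments of the symbol powers *)

Section SymbolMoments.
Local Open Scope classical_set_scope.
Local Open Scope ereal_scope.
Context {R : realType} {dT dT' : measure_display} {T : measurableType dT}
  {T' : measurableType dT'} {P : probability T R} {P' : probability T' R}
  {N M : nat} {pilots : {set 'I_N * 'I_M}} {d : T' -> R[i]}
  {S : T -> 'M[R[i]]_(N, M)}.
Context (hd : data_symbol P' d) (hS : symbol_matrix P P' pilots d S).

Definition power (i : 'I_N * 'I_M) (w : T) : R := sqr_norm (re_im (S w i.1 i.2)).

Lemma power_ge0 i w : (0 <= power i w)%R.
Proof. exact: sqr_norm_ge0. Qed.

Lemma power_pilot i w : i \in pilots -> power i w = 1%R.
Proof.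
move=> /(pilot_entry hS)[s s1 Ss]; rewrite /power Ss.
by apply: (@complexI R); rewrite -sqr_normC s1 expr1n.
Qed.

Lemma measurable_power i : measurable_fun setT (power i).
Proof.
have [ip|ip] := boolP (i \in pilots).
  by rewrite (_ : power i = cst 1%R)//; apply/funext => w; exact: power_pilot.
apply: (measurableT_comp measurable_sqr_norm).
exact/complex_rv_re_im/(data_entry_rv hS).
Qed.

Lemma integral_data_law i (f : measurableTypeR R * measurableTypeR R -> \bar R) :
  i \notin pilots -> measurable_fun setT f -> (forall p, 0 <= f p) ->
  \int[P]_w f (re_im (S w i.1 i.2)) = \int[P']_w f (re_im (d w)).
Proof.
move=> ip mf f0; apply: ge0_integral_eq_law => //.
- exact/complex_rv_re_im/(data_entry_rv hS).
- exact/complex_rv_re_im/(data_rv hd).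
- exact: (data_entry_law hS).
Qed.

(** [kurtosis] is defined through [fine], which would turn an infinite value into 0; the finite
    fourth moment excludes this. *)
Lemma kurtosisE :
  \int[P']_w (sqr_norm (re_im (d w)) ^+ 2)%:E = (kurtosis P' d)%:E.
Proof.
have E4 : 'E_P'[fun w => (Normc.normc (d w) ^+ 4)%R] =
    \int[P']_w (sqr_norm (re_im (d w)) ^+ 2)%:E.
  by rewrite unlock; apply: eq_integral => w _; rewrite normc4E.
have := data_moment4 hd; rewrite /kurtosis E4 => fin.
rewrite fineK// ge0_fin_numE//.
by apply: integral_ge0 => w _; rewrite lee_fin sqr_ge0.
Qed.

Lemma integral_power i : \int[P]_w (power i w)%:E = 1.
Proof.
have [ip|ip] := boolP (i \in pilots).
  under eq_integral do rewrite power_pilot//.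
  by rewrite integral_cst// mul1e; exact: probability_setT.
have mf := measurable_sqr_norm (R := R).
rewrite (integral_data_law i (EFin \o sqr_norm))//; last 2 first.
- by apply/measurable_EFinP.
- by move=> p; rewrite lee_fin sqr_norm_ge0.
have := data_power hd; rewrite unlock => <-.
by apply: eq_integral => w _; rewrite sqr_normc.
Qed.

Lemma integral_sqr_power i :
  \int[P]_w (power i w * power i w)%:E =
  (1 + (i \notin pilots)%:R * (kurtosis P' d - 1))%:E.
Proof.
have [ip|ip] := boolP (i \in pilots).
  under eq_integral do rewrite !power_pilot// mulr1.
  by rewrite integral_cst// mul1e mul0r addr0; exact: probability_setT.
rewrite mul1r addrC subrK -kurtosisE.
have mf := measurable_sqr_norm (R := R).
rewrite -(integral_data_law i (fun p => (sqr_norm p ^+ 2)%:E))//.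
- by apply/measurable_EFinP; exact: measurable_funX.
- by move=> p; rewrite lee_fin sqr_ge0.
Qed.

(** If one position is a pilot, its power is the constant 1 and the mean of the other remains.
    Otherwise independence splits the integral into two unit means. *)
Lemma integral_power_neq i j : i != j ->
  \int[P]_w (power i w * power j w)%:E = 1.
Proof.
move=> ij.
have [ip|ip] := boolP (i \in pilots).
  by under eq_integral do rewrite power_pilot// mul1r; exact: integral_power.
have [jp|jp] := boolP (j \in pilots).
  under eq_integral do rewrite [power j _]power_pilot// mulr1.
  exact: integral_power.
under eq_integral do rewrite EFinM.
rewrite (ge0_integralM_indep P
  (fun w => re_im (S w i.1 i.2)) (fun w => re_im (S w j.1 j.2))
  (EFin \o sqr_norm) (EFin \o sqr_norm)).
- by rewrite -[RHS]mule1 -{1}(integral_power i) -(integral_power j).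
- exact/complex_rv_re_im/(data_entry_rv hS).
- exact/complex_rv_re_im/(data_entry_rv hS).
- move=> A B mA mB.
  have indepS := data_entry_indep hS.
  (* Pairwise independence is mutual independence on the subfamily [{i, j}]; as [i != j], one family
     of sets can take the value [A] at [i] and [B] at [j]. *)
  have := indepS [set i; j]%SET (fun l => if l == i then A else B).
  rewrite finset.subUset !finset.sub1set !finset.in_setC ip jp => /(_ erefl) indep.
  rewrite (_ : _ `&` _ = \bigcap_(l in [set` [set i; j]%SET])
      [set w | (if l == i then A else B) (re_im (S w l.1 l.2))]).
    rewrite indep => [|l]; last by case: ifP.
    by rewrite big_setU1 ?finset.inE//= big_set1 eqxx eq_sym (negbTE ij).
  apply/seteqP; split => w /=.
    move=> [Aw Bw] l; rewrite /= !finset.inE => /orP[]/eqP->.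
      by rewrite eqxx.
    by rewrite eq_sym (negbTE ij).
  move=> H; split.
    by have := H i; rewrite /= eqxx; apply; rewrite !finset.inE eqxx.
  have := H j; rewrite /= eq_sym (negbTE ij); apply.
  by rewrite !finset.inE eqxx orbT.
- by apply/measurable_EFinP; exact: measurable_sqr_norm.
- by apply/measurable_EFinP; exact: measurable_sqr_norm.
- by move=> x; rewrite lee_fin sqr_norm_ge0.
- by move=> x; rewrite lee_fin sqr_norm_ge0.
Qed.

(** The constant 1 is kept apart from the excess at equal data positions, so that the two can be
    summed separately over all pairs. *)
Lemma integral_powerM i j : \int[P]_w (power i w * power j w)%:E =
  (1 + (i == j)%:R * (i \notin pilots)%:R * (kurtosis P' d - 1))%:E.
Proof.
have [->|ij] := eqVneq i j; first by rewrite mul1r integral_sqr_power.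
by rewrite !mul0r addr0 integral_power_neq.
Qed.

(** Needed for linearity of the integral, since the real coefficients of these products may be
    negative. *)
Lemma integrable_powerM i j :
  P.-integrable setT (fun w => (power i w * power j w)%:E).
Proof.
apply/integrableP; split.
  by apply/measurable_EFinP; apply: measurable_funM; exact: measurable_power.
under eq_integral do rewrite gee0_abs ?lee_fin ?mulr_ge0 ?power_ge0//.
by rewrite integral_powerM ltry.
Qed.

End SymbolMoments.
Arguments power {R dT T N M} S i w.

(** * Mean squared modulus of the ambiguity function *)

Theorem theorem2 (R : realType)
  (dT dT' : measure_display) (T : measurableType dT) (T' : measurableType dT')
  (P : probability T R) (P' : probability T' R)
  (N M L : nat) (hN : (1 <= N)%N) (hM : (1 <= M)%N) (hL : (L <= M * N)%N)
  (pilots : {set 'I_N * 'I_M}) (hpilots : #|pilots| = L)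
  (d : T' -> R[i]) (hd : data_symbol P' d)
  (S : T -> 'M[R[i]]_(N, M)) (hS : symbol_matrix P P' pilots d S)
  (k : 'I_N) (q : 'I_M) :
  'E_P[fun w => (Normc.normc (fst_af (ofdm (S w)) k q) ^+ 2)%R]%E =
  ((M ^ 2 * N ^ 2)%:R * ((k : nat) == 0%N)%:R * ((q : nat) == 0%N)%:R
   + (kurtosis P' d - 1) * ((M * N)%:R - L%:R))%:E.
Proof.
pose c (i : 'I_N * 'I_M) : R[i] :=
  Num.conj (zeta M ^+ (q * i.2)) * zeta N ^+ (i.1 * k).
pose K i j := complex.Re (c i * Num.conj (c j)).
have Kii i : K i i = 1.
  have norm1 n x : zeta n ^+ x * Num.conj (zeta n ^+ x) = 1 :> R[i].
    by rewrite rmorphXn -exprMn zeta_conj expr1n.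
  by rewrite /K /c rmorphM /= conjCK mulrACA norm1 mulr1 mulrC norm1.
(* The weight is a product of a row character and a conjugated column character, so the sum factors
   into two instances of [sum_zeta], one of them conjugated. *)
have sumc : \sum_i c i =
    (((k : nat) == 0%N)%:R * N%:R) * (((q : nat) == 0%N)%:R * M%:R).
  rewrite -sum_zeta; have := congr1 Num.conj (sum_zeta (R := R) M q).
  rewrite rmorphM !rmorph_nat => <-.
  rewrite rmorph_sum big_distrlr pair_big; apply: eq_bigr => -[a m] _ /=.
  by rewrite /c mulrC [(m * q)%N]mulnC.
have afE w : (Normc.normc (fst_af (ofdm (S w)) k q) ^+ 2)%:E =
    (\sum_p (K p.1 p.2)%:E * (power S p.1 w * power S p.2 w)%:E)%E.
  transitivity (Normc.normc (\sum_i c i * (power S i w)%:C%C) ^+ 2)%:E.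
    rewrite fst_af_ofdm exchange_big pair_big /=; congr (Normc.normc _ ^+ 2)%:E.
    by apply: eq_bigr => i _; rewrite -sqr_normC.
  by rewrite sqr_normc_sum pair_big -sumEFin.
rewrite unlock.
under eq_integral do rewrite afE.
rewrite integral_sum//=; last first.
  by move=> p; apply: integrableZl => //; exact: (integrable_powerM hd hS).
under eq_bigr => p _.
  rewrite integralZl//; last exact: (integrable_powerM hd hS).
  rewrite (integral_powerM hd hS) -EFinM; over.
rewrite sumEFin; congr EFin.
(* Back to a nested sum: for fixed [i], the excess survives only at [j = i], where [K i i = 1]. *)
rewrite -(pair_big xpredT xpredT (fun i j => K i j *
  (1 + (i == j)%:R * (i \notin pilots)%:R * (kurtosis P' d - 1)))) /=.
under eq_bigr => i _.
  under eq_bigr => j _ do rewrite mulrDr mulr1.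
  rewrite big_split /= [X in _ + X](bigD1 i)//= eqxx Kii mul1r.
  rewrite [X in _ + (_ + X)]big1 ?addr0; last first.
    by move=> j ji; rewrite eq_sym (negbTE ji) !mul0r mulr0.
  rewrite mul1r; over.
rewrite big_split /= -mulr_suml [(_ - 1) * _]mulrC; congr (_ + _ * _).
  (* This is [sqr_normc_sum] read backwards with every [y i] equal to 1. *)
  have sumK : \sum_i \sum_j K i j = Normc.normc (\sum_i c i) ^+ 2.
    rewrite (eq_bigr (fun i => c i * 1%:C%C)) ?sqr_normc_sum; last first.
      by move=> i _; rewrite rmorph1 mulr1.
    by apply: eq_bigr => i _; apply: eq_bigr => j _; rewrite !mulr1.
  rewrite sumK sumc -!natrM sqr_normc_nat -natrX; congr _%:R.
  by case: eqP; case: eqP; rewrite ?mul1n ?mul0n ?muln0 ?muln1// expnMn mulnC.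
(* Writing [M * N] as [L] plus the number of data positions makes the subtraction of [L] cancel
   exactly. *)
have := cardsC pilots; rewrite card_prod !card_ord hpilots mulnC => <-.
rewrite natrD addrC addKr -natr_sum; congr _%:R.
rewrite -sum1_card [RHS]big_mkcond; apply: eq_bigr => i _.
by rewrite finset.in_setC; case: (i \in pilots).
Qed.
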